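(* Let $G$ be the group of real points of a connected semisimple algebraic group defined over $\mathbb{Q}$, with $G\subset SL_n(\mathbb{R})$, of noncompact type with finite center, and let $\Gamma\subset G$ be an irreducible lattice commensurable with $G_{\mathbb Z}=G\cap SL_n(\mathbb Z)$. Let $u=\exp v$ with $v$ nilpotent in the Lie algebra of $G$, $U=\{\exp(tv):t\in\mathbb R\}$, and let $\xi\in G$ be such that the $U$-orbit of $x=\Gamma\xi$ in $X=\Gamma\backslash G$ is equidistributed with respect to the $G$-invariant probability measure $\nu_G$. Define $\chi:\xi N_G(U)\xi^{-1}\to\mathbb R^*$ by $\mathrm{Ad}(\beta)(\mathrm{Ad}(\xi)v)=\chi(\beta)\mathrm{Ad}(\xi)v$. If $S\subset \xi N_G(U)\xi^{-1}$ is (the group of real points of) a $\mathbb{Q}$-split torus defined over $\mathbb{Q}$, then $\chi(S)=\{1\}$.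
   Context: Equidistribution of the $U$-orbit of $x$ means the orbit averages of every bounded continuous function converge to its $\nu_G$-integral. Noncompact type means no compact factors. A $\mathbb Q$-split $\mathbb Q$-torus is an algebraic torus in $G$ defined over $\mathbb Q$ and diagonalizable over $\mathbb Q$. *)

(* Defs.v *)
From HB Require Import structures.
From mathcomp Require Import all_boot all_order all_algebra generic_quotient.
From mathcomp Require Import all_classical all_reals all_analysis.
From mathcomp Require complex mpoly.

Set Implicit Arguments.
Unset Strict Implicit.
Unset Printing Implicit Defensive.

Import Order.TTheory GRing.Theory Num.Theory.
Import numFieldNormedType.Exports.
Import complex.

Local Open Scope classical_set_scope.
Local Open Scope ring_scope.
Local Open Scope quotient_scope.

(* The notations of multinomials clash with those of MathComp-Analysis, hence
   the qualified names below. [entry_poly n K] is the ring of polynomials in the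
   n * n matrix entries, the variables being numbered as in [mxvec]. *)
Definition entry_poly (n : nat) (K : nzRingType) := mpoly.mpoly (n * n) K.

Section MatrixGroups.
Variables (K : fieldType) (n : nat).
Implicit Types (A B : 'M[K]_n) (G H N : set 'M[K]_n).

Definition group_set H : Prop :=
  [/\ H `<=` [set A | A \in unitmx],
      H 1%:M,
      (forall A B, H A -> H B -> H (A *m B)) &
      (forall A, H A -> H (invmx A))].

Definition Ad A B : 'M[K]_n := A *m B *m invmx A.

Definition normal_subgroup G N : Prop :=
  [/\ group_set N, N `<=` G & forall g a, G g -> N a -> N (Ad g a)].

Definition derived_subgroup H : set 'M[K]_n :=
  smallest group_set
    [set a *m b *m invmx a *m invmx b | a in H & b in H].

Definition solvable_group H : Prop :=
  exists k, iter k derived_subgroup H = [set 1%:M].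

Definition center_set G : set 'M[K]_n :=
  [set z | G z /\ forall g, G g -> g *m z = z *m g].

Definition normalizer_set G H : set 'M[K]_n :=
  [set g | G g /\ Ad g @` H = H].

(* [finite_index H G] is meant for subgroups H of G: finitely many right
   cosets of H cover G. *)
Definition finite_index H G : Prop :=
  exists s : seq 'M[K]_n, G `<=` [set h *m c | h in H & c in [set` s]].

Definition commensurable G H : Prop :=
  finite_index (G `&` H) G /\ finite_index (G `&` H) H.

Definition zeros (I : set (entry_poly n K)) : set 'M[K]_n :=
  [set A | forall p, I p -> mpoly.meval (fun k => mxvec A 0 k) p = 0].

Definition zariski_closed (Z : set 'M[K]_n) : Prop := exists I, Z = zeros I.

Definition zariski_connected (Z : set 'M[K]_n) : Prop :=
  forall Z1 Z2, zariski_closed Z1 -> zariski_closed Z2 ->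
    Z = Z1 `|` Z2 -> Z1 `&` Z2 = set0 -> Z1 = set0 \/ Z2 = set0.

(* K-points of the closed subset of the space of matrices defined by a set of
   polynomials with rational coefficients. *)
Definition points (E : set (entry_poly n rat)) : set 'M[K]_n :=
  zeros [set mpoly.map_mpoly ratr p | p in E].

End MatrixGroups.

Arguments points K {n} E.

Section AlgebraicGroups.
Variables (R : realType) (n : nat).
Local Notation C := (complex R).

Definition complex_points (E : set (entry_poly n rat)) : set 'M[C]_n :=
  points C E.

Definition real_points (E : set (entry_poly n rat)) : set 'M[R]_n :=
  points R E.

(* In characteristic zero, an algebraic subgroup of SL_n defined over the
   rationals is the same as a subgroup of SL_n(C) which is the zero set of
   polynomials with rational coefficients. *)
Definition Q_group (E : set (entry_poly n rat)) : Prop :=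
  group_set (complex_points E) /\ complex_points E `<=` [set A | \det A = 1].

Definition connected_semisimple (G : set 'M[C]_n) : Prop :=
  zariski_connected G /\
  forall N, normal_subgroup G N -> zariski_closed N -> zariski_connected N ->
    solvable_group N -> N = [set 1%:M].

Definition Q_split_torus (F : set (entry_poly n rat)) : Prop :=
  [/\ Q_group F,
      zariski_connected (complex_points F) &
      exists2 P : 'M[rat]_n, P \in unitmx &
        forall A, complex_points F A -> is_diag_mx (Ad (map_mx ratr P) A)].

End AlgebraicGroups.

Arguments complex_points R {n} E.
Arguments real_points R {n} E.

Section LinearGroups.
Variables (R : realType) (n : nat).

Record mxgroup := MxGroup {
  mxgroup_set :> set 'M[R]_n ;
  mxgroupP : group_set mxgroup_set }.

Definition expmx (X : 'M[R]_n) : 'M[R]_n :=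
  limn (series (fun k => (k`!%:R)^-1 *: X ^+ k)).

Definition lie_algebra (G : set 'M[R]_n) : set 'M[R]_n :=
  [set X | forall t : R, G (expmx (t *: X))].

Definition one_param_subgroup (v : 'M[R]_n) : set 'M[R]_n :=
  [set expmx (t *: v) | t in [set: R]].

Definition integer_points (G : set 'M[R]_n) : set 'M[R]_n :=
  G `&` [set map_mx intr B | B in [set: 'M[int]_n]].

Definition identity_component (G : set 'M[R]_n) : set 'M[R]_n :=
  connected_component G 1%:M.

Definition noncompact_type (G : set 'M[R]_n) : Prop :=
  forall N, normal_subgroup (identity_component G) N ->
    connected N -> compact N -> N = [set 1%:M].

(* G need not be connected as a Lie group, so density is required in its
   identity component only. *)
Definition irreducible_in (G Gamma : set 'M[R]_n) : Prop :=
  forall N, normal_subgroup (identity_component G) N -> closed N ->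
    ~ compact N ->
    identity_component G `<=` closure [set c *m a | c in Gamma & a in N].

Section Elements.
Variable G : mxgroup.

Definition elt : Type := set_type (mxgroup_set G).
HB.instance Definition _ := Topological.copy elt (set_type (mxgroup_set G)).

Definition Elt A (GA : mxgroup_set G A) : elt := exist _ A (mem_set GA).
Definition mx_of (g : elt) : 'M[R]_n := sval g.

Lemma mx_ofP (g : elt) : mxgroup_set G (mx_of g).
Proof. exact: set_mem (svalP g). Qed.

Lemma group_mul (g h : elt) : mxgroup_set G (mx_of g *m mx_of h).
Proof. by case: (mxgroupP G) => _ _ GM _; apply: GM; apply: mx_ofP. Qed.

Lemma group_one : mxgroup_set G 1%:M.
Proof. by case: (mxgroupP G). Qed.

Definition mul_elt (g h : elt) : elt := Elt (group_mul g h).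

HB.instance Definition _ := isPointed.Build elt (Elt group_one).

End Elements.

Section HomogeneousSpace.
Variables (G Gamma : mxgroup).

Definition same_coset (g h : elt G) : bool :=
  `[< exists2 c, mxgroup_set Gamma c & mx_of h = c *m mx_of g >].

Lemma same_coset_refl : reflexive same_coset.
Proof.
by move=> g; apply/asboolP; exists 1%:M; [exact: group_one|rewrite mul1mx].
Qed.

Lemma same_coset_sym : symmetric same_coset.
Proof.
suff sub g h : same_coset g h -> same_coset h g.
  by move=> g h; apply/idP/idP => /sub.
move=> /asboolP[c Gc hE]; apply/asboolP; case: (mxgroupP Gamma) => GU _ _ GV.
by exists (invmx c); [exact: GV|rewrite hE mulKmx// GU].
Qed.

Lemma same_coset_trans : transitive same_coset.
Proof.
move=> h g k /asboolP[c Gc hE] /asboolP[d Gd kE]; apply/asboolP.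
case: (mxgroupP Gamma) => _ _ GM _.
by exists (d *m c); [exact: GM|rewrite kE hE mulmxA].
Qed.

Canonical coset_equiv :=
  EquivRel same_coset same_coset_refl same_coset_sym same_coset_trans.

(* The space of right cosets of Gamma in G, with the quotient topology. *)
Definition homspace : Type := quotient_topology {eq_quot coset_equiv}.
HB.instance Definition _ := PointedTopological.on homspace.

Definition coset (g : elt G) : homspace := \pi_{eq_quot coset_equiv} g.

Definition coset_repr (x : homspace) : elt G :=
  repr (x : {eq_quot coset_equiv}).

Definition rtrans (g : elt G) (x : homspace) : homspace :=
  coset (mul_elt (coset_repr x) g).

Definition borel_homspace := g_sigma_algebraType (@open homspace).

Definition invariant_measure (nu : probability borel_homspace R) : Prop :=
  forall (g : elt G) (A : set borel_homspace), measurable A ->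
    nu (rtrans g @^-1` A) = nu A.

Definition lattice_in : Prop :=
  [/\ mxgroup_set Gamma `<=` mxgroup_set G,
      (forall c, mxgroup_set Gamma c ->
         \forall A \near nbhs c, mxgroup_set Gamma A -> A = c) &
      exists nu : probability borel_homspace R, invariant_measure nu].

(* Equidistribution of the orbit of x under the one-parameter subgroup
   generated by v; [Gv] puts this subgroup inside G. *)
Definition orbit_equidistributed (nu : probability borel_homspace R)
    (v : 'M[R]_n) (Gv : lie_algebra G v) (x : homspace) : Prop :=
  forall f : homspace -> R, continuous f -> bounded_fun f ->
    (fun T : R => T^-1 *
       \int[lebesgue_measure]_(t in `[0, T]) f (rtrans (Elt (Gv t)) x))
      @ +oo --> \int[nu]_x f x.

End HomogeneousSpace.
End LinearGroups.

(* Main.v *)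
(* Write w = Ad(xi) v. If s in S has chi(s) <> 1, then w has a nonzero
   (i, j)-entry in a rational eigenbasis of S, and the characters x_i and x_j
   differ on S. As S is connected, x_i / x_j is not torsion modulo the characters
   trivial on S, so some rational cocharacter y has y_i <> y_j; by independence
   of characters S is cut out by relations between monomials, whence S contains
   t = exp(y) with chi(t) <> 1.
   Every entry of w joins eigenvectors whose y-weights differ by y_i - y_j, and
   det t = 1, so an extremal eigenvector gives an integral row e with e w = 0 and
   e t = l e, where l > 1 up to replacing t by its inverse. Then e exp(r w) = e
   for all r, so that the closure of e Gamma g contains e xi at every point
   Gamma g of the U-orbit of x. The failure of this property defines an open set,
   which is nu-null by equidistribution; by invariance of nu there is h in G such
   that the property holds at Gamma h t^k xi for all k in nat. Hence l^-k e h^-1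
   is in the closure of e Gamma for all k, and e Gamma accumulates at 0. But Gamma
   is commensurable with the integral points, so e Gamma lies in a finite union
   of lattices and avoids 0: a contradiction. *)
Require Import Defs.
From HB Require Import structures.
From mathcomp Require Import all_boot all_order all_algebra generic_quotient.
From mathcomp Require Import all_classical all_reals all_analysis.
From mathcomp Require complex mpoly.
From mathcomp Require Import measurable_realfun ring lra.

Set Implicit Arguments.
Unset Strict Implicit.
Unset Printing Implicit Defensive.

Import Order.TTheory GRing.Theory Num.Theory.
Import numFieldNormedType.Exports.
Import complex.
Import (canonicals, coercions) mpoly.

Local Open Scope classical_set_scope.
Local Open Scope ring_scope.

(** * Diagonalizable groups *)

Section IndependenceOfCharacters.
Variables (K : fieldType) (T : Type) (I : eqType).
Variables (H : set T) (mul : T -> T -> T) (one : T) (chi : I -> T -> K).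
Hypotheses (H1 : H one) (HM : forall g h, H g -> H h -> H (mul g h)).
Hypotheses (chi1 : forall a, chi a one = 1)
  (chiM : forall a g h, H g -> H h -> chi a (mul g h) = chi a g * chi a h).

(** Different indices may carry the same character on [H], as different monomials may agree on a
    torus; only classes of indices can be independent. *)
Let same a b := `[< forall h, H h -> chi a h = chi b h >].

(* Dedekind's argument: a relation between characters, translated by g and
   corrected by a multiple of itself, loses the term of a character outside the
   class of a0 and multiplies the coefficient sum of the class by a unit. *)
Lemma character_class_sum (a0 : I) (s : seq I) (c : I -> K) :
  (forall h, H h -> \sum_(a <- s) c a * chi a h = 0) ->
  \sum_(a <- s | same a0 a) c a = 0.
Proof.
move=> cs0; rewrite -big_filter; set r := [seq a <- s | _].
have : forall h, H h -> \sum_(a <- r) c a * chi a h +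
    \sum_(a <- [seq b <- s | ~~ same a0 b]) c a * chi a h = 0.
  by move=> h Hh; rewrite -[RHS](cs0 h Hh) /r !big_filter [RHS](bigID (same a0)).
have : all (same a0) r by exact: seq.filter_all.
have : all (predC (same a0)) [seq b <- s | ~~ same a0 b] by exact: seq.filter_all.
rewrite {}/r; move: [seq a <- s | same a0 a] => r.
(* Induction on the terms outside the class; [c] is generalized because each elimination changes the
   coefficients. *)
elim: [seq b <- s | ~~ _] c r {cs0} => [|b t IH] c r.
  move=> _ r0 /(_ _ H1); rewrite big_nil addr0 => E; rewrite -[RHS]E.
  by apply: eq_bigr => a _; rewrite chi1 mulr1.
move=> /andP[/= nb nt] r0 E.
have [g Hg gb] : exists2 g, H g & chi a0 g != chi b g.
  apply: contrapT => nex; move/asboolP: nb; apply => h Hh.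
  by apply/eqP; apply: contrapT => /negP e; apply: nex; exists h.
have := IH (fun a => c a * (chi a g - chi b g)) r nt r0.
have -> : \sum_(a <- r) c a * (chi a g - chi b g) =
    (\sum_(a <- r) c a) * (chi a0 g - chi b g).
  by rewrite mulr_suml; apply: eq_big_seq => a /(allP r0) /asboolP /(_ _ Hg) ->.
move=> IH'; suff /eqP : (\sum_(a <- r) c a) * (chi a0 g - chi b g) = 0.
  by rewrite mulf_eq0 subr_eq0 (negPf gb) orbF => /eqP.
apply: IH' => h Hh.
have := E _ (HM Hg Hh); have := E _ Hh; rewrite !big_cons => E1 E2.
have D l : \sum_(a <- l) c a * (chi a g - chi b g) * chi a h =
    \sum_(a <- l) c a * chi a (mul g h) - chi b g * \sum_(a <- l) c a * chi a h.
  rewrite mulr_sumr -sumrB; apply: eq_bigr => a _.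
  by rewrite chiM // mulrBr mulrBl -mulrA (mulrC (c a) (chi b g)) -mulrA.
rewrite !D -[RHS](subr0 0) -[X in _ = X - _]E2 -[X in _ = _ - X](mulr0 (chi b g)).
rewrite -[X in _ = _ - _ * X]E1 chiM //; ring.
Qed.

(** On a class of equal characters [z] is constant and the coefficients sum to 0, so the class
    contributes nothing. Classes are removed one at a time, starting with that of the head of
    [s]. *)
Lemma character_relation (s : seq I) (c z : I -> K) :
  (forall a b, (forall h, H h -> chi a h = chi b h) -> z a = z b) ->
  (forall h, H h -> \sum_(a <- s) c a * chi a h = 0) ->
  \sum_(a <- s) c a * z a = 0.
Proof.
move=> zP; have [k] := ubnP (size s); elim: k s => // k IH [|a0 s] sk cs0.
  by rewrite big_nil.
rewrite (bigID (same a0)) /= -[X in _ + X]big_filter.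
have cl f : (forall a, same a0 a -> f a = f a0) ->
    \sum_(a <- a0 :: s | same a0 a) c a * f a = 0.
  move=> fP; have -> : \sum_(a <- a0 :: s | same a0 a) c a * f a =
      (\sum_(a <- a0 :: s | same a0 a) c a) * f a0.
    by rewrite mulr_suml; apply: eq_bigr => a /fP ->.
  by rewrite (character_class_sum _ cs0) mul0r.
rewrite cl ?add0r; last by move=> a /asboolP e; apply: zP => h /e.
apply: IH => [|h Hh].
  rewrite /= (_ : same a0 a0) /=; last exact/asboolP.
  rewrite /= ltnS in sk.
  by apply: leq_ltn_trans sk; rewrite size_filter count_size.
rewrite big_filter -[RHS](cs0 h Hh) [RHS](bigID (same a0)).
by rewrite /= (cl (chi^~ h)) ?add0r // => a /asboolP/(_ _ Hh) ->.
Qed.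

End IndependenceOfCharacters.

(** Among the matrices with row space inside [V], one of maximal rank has row space equal to [V].
    Some column of its cokernel matrix is then nonzero on [x]. *)
Lemma linear_separation (F : fieldType) n (V : set 'rV[F]_n) (x : 'rV[F]_n) :
  V 0 -> (forall a u w, V u -> V w -> V (a *: u + w)) ->
  ~ V x -> exists2 y : 'cV[F]_n, forall u, V u -> u *m y = 0 & x *m y != 0.
Proof.
move=> V0 VL Vx.
pose Q r := `[< exists B : 'M[F]_n, (forall u, (u <= B)%MS -> V u) /\ \rank B = r >].
have exQ : exists r, Q r.
  exists 0; apply/asboolP; exists 0; split; last exact: mxrank0.
  by move=> u; rewrite submx0 => /eqP ->.
have Qn r : Q r -> (r <= n)%N by move=> /asboolP[B [_ <-]]; exact: rank_leq_col.
case: (ex_maxnP exQ Qn) => r /asboolP[B [BV Br]] maxr.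
have VB u : V u -> (u <= B)%MS.
  move=> Vu; apply: contrapT => /negP uB.
  have : Q (\rank (B + u)%MS).
    apply/asboolP; exists (B + u)%MS; split=> // w /sub_addsmxP [[w1 w2] /= ->].
    rewrite [w2]mx11_scalar mul_scalar_mx addrC; apply: VL => //.
    by apply: BV; exact: submxMl.
  move=> /maxr; rewrite -Br; apply/negP; rewrite -ltnNge.
  apply: rank_ltmx; rewrite ltmxE addsmxSl /=.
  by apply: contra uB; apply: submx_trans; exact: addsmxSr.
have : ~~ (x <= B)%MS by apply/negP => /BV.
rewrite submxE => /rV0Pn[j xj]; exists (col j (cokermx B)) => [u|].
  by move=> /VB; rewrite submxE => /eqP uB; rewrite colE mulmxA uB mul0mx.
by apply/matrix0Pn; exists 0, 0; rewrite colE mulmxA -colE mxE.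
Qed.

(** * Rational polynomials on groups of diagonal matrices *)

Section PolynomialPoints.

Lemma meval_map_ratr (K : fieldType) k (p : mpoly.mpoly k rat) (x : 'I_k -> K) :
  mpoly.meval x (mpoly.map_mpoly ratr p) =
  \sum_(m <- mpoly.msupp p)
    ratr (mpoly.mcoeff m p) * \prod_i x i ^+ mpoly.fun_of_multinom m i.
Proof.
rewrite /mpoly.map_mpoly [X in mpoly.meval _ X]/mpoly.mmap raddf_sum /=.
apply: eq_bigr => m _.
rewrite mpoly.mevalM mpoly.mevalC rmorph_prod /=; congr (_ * _).
by apply: eq_bigr => i _; rewrite rmorphXn /= mpoly.mevalXU.
Qed.

(** A field morphism is injective and fixes the rational coefficients. This serves to pass between
    real and complex points. *)
Lemma points_map (K L : fieldType) (f : {rmorphism K -> L}) n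
    (E : set (entry_poly n rat)) (A : 'M[K]_n) :
  points L E (map_mx f A) <-> points K E A.
Proof.
have eqf p : mpoly.meval (fun k => mxvec (map_mx f A) 0 k)
      (mpoly.map_mpoly ratr p) =
    f (mpoly.meval (fun k => mxvec A 0 k) (mpoly.map_mpoly ratr p)).
  rewrite !meval_map_ratr rmorph_sum; apply: eq_bigr => m _ /=.
  rewrite rmorphM fmorph_rat rmorph_prod; congr (_ * _); apply: eq_bigr => i _.
  by rewrite rmorphXn -map_mxvec mxE.
split=> EA _ [p Ep <-].
  by apply/eqP; rewrite -(fmorph_eq0 f) -eqf; apply/eqP; apply: EA; exists p.
by rewrite eqf; have /= -> := EA _ (ex_intro2 _ _ p Ep erefl); rewrite rmorph0.
Qed.

Variables (K : fieldType) (n : nat).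
Implicit Types (A P Q : 'M[K]_n) (d : 'rV[K]_n).

(** The entries of [Q *m diag_mx d *m P] are linear forms in [d], which are substituted into [p]. *)
Lemma meval_diag P Q (p : entry_poly n K) :
  exists q : mpoly.mpoly n K, forall d,
    mpoly.meval (fun k => mxvec (Q *m diag_mx d *m P) 0 k) p =
    mpoly.meval (fun i => d 0 i) q.
Proof.
pose M : 'M[mpoly.mpoly n K]_n := \matrix_(i, j)
  \sum_l (Q i l * P l j) *: mpoly.mpolyX K (mpoly.mnm1 l).
exists (mpoly.comp_mpoly [tuple mxvec M 0 k | k < (n * n)%N] p) => d.
rewrite mpoly.comp_mpoly_meval; apply: mpoly.meval_eq => k /=.
rewrite tnth_mktuple; case/mxvec_indexP: k => i j; rewrite !mxvecE !mxE.
rewrite raddf_sum; apply: eq_bigr => l _ /=.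
rewrite mpoly.mevalZ mpoly.mevalXU mxE (bigD1 l) //= big1 ?addr0 => [|l' ll'].
  by rewrite mxE eqxx mulr1n mulrAC.
by rewrite mxE (negPf ll') mulr0.
Qed.

Lemma meval_diag_entry P Q (i : 'I_n) :
  exists q : entry_poly n K, forall A,
    mpoly.meval (fun k => mxvec A 0 k) q = (P *m A *m Q) i i.
Proof.
exists (\sum_b \sum_a (P i a * Q b i) *:
  mpoly.mpolyX K (mpoly.mnm1 (mxvec_index a b))) => A.
rewrite raddf_sum /= mxE; apply: eq_bigr => b _; rewrite raddf_sum /= mxE mulr_suml.
by apply: eq_bigr => a _; rewrite mpoly.mevalZ mpoly.mevalXU mxvecE mulrAC.
Qed.

Definition monomial (m : mpoly.multinom n) d : K :=
  \prod_i d 0 i ^+ mpoly.fun_of_multinom m i.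

(** An equation of the group, pulled back to [d], is a linear relation between monomials, and
    monomials are characters of [H]. By independence of characters, the coincidences between
    monomials on [H] imply all equations. *)
Lemma diagonal_group_relations (E : set (entry_poly n rat)) P Q (z : 'rV[K]_n) :
  let H := [set d | points K E (Q *m diag_mx d *m P)] in
  H (const_mx 1) ->
  (forall d e, H d -> H e -> H (\row_i (d 0 i * e 0 i))) ->
  (forall a b, (forall d, H d -> monomial a d = monomial b d) ->
     monomial a z = monomial b z) ->
  H z.
Proof.
move=> H H1 HM zP _ [p Ep <-].
have [q qE] := meval_diag P Q (mpoly.map_mpoly ratr p).
rewrite qE mpoly.mevalE.
apply: (@character_relation K _ _ H (fun d e => \row_i (d 0 i * e 0 i))
  (const_mx 1) monomial H1 HM) => //.
- by move=> a; rewrite /monomial big1 // => i _; rewrite mxE expr1n.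
- move=> a d e _ _; rewrite /monomial -big_split /=.
  by apply: eq_bigr => i _; rewrite mxE exprMn.
- by move=> d Hd; rewrite /monomial -mpoly.mevalE -qE; apply: Hd; exists p.
Qed.

End PolynomialPoints.

(** The factorization of x^m - y^m into x - y and a cofactor splits the set into two closed pieces.
    They are disjoint, and [A0] lies in the first, so connectedness empties the second. *)
Lemma zariski_connected_torsion_free (K : numFieldType) n
    (E : set (entry_poly n rat)) (P Q : 'M[K]_n) (i j : 'I_n) m :
  let x A := (P *m A *m Q) i i in let y A := (P *m A *m Q) j j in
  zariski_connected (points K E) -> (0 < m)%N ->
  (forall A, points K E A -> x A != 0 /\ x A ^+ m = y A ^+ m) ->
  (exists2 A, points K E A & x A = y A) ->
  forall A, points K E A -> x A = y A.
Proof.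
move=> x y conn m0 xy [A0 EA0 xyA0] A EA.
have [p pE] := meval_diag_entry P Q i; have [q qE] := meval_diag_entry P Q j.
pose I : set (entry_poly n K) := [set mpoly.map_mpoly ratr p | p in E].
pose t := \sum_(k < m) p ^+ (m.-1 - k) * q ^+ k : entry_poly n K.
have tE B : mpoly.meval (fun k => mxvec B 0 k) t =
    \sum_(k < m) x B ^+ (m.-1 - k) * y B ^+ k.
  rewrite raddf_sum; apply: eq_bigr => k _ /=.
  by rewrite mpoly.mevalM !rmorphXn /= pE qE.
have ZU r B : zeros (I `|` [set r]) B <->
    points K E B /\ mpoly.meval (fun k => mxvec B 0 k) r = 0.
  split=> [Z|[ZB rB] s [/ZB //|->//]].
  by split=> [s Is|]; apply: Z; [left|right].
case: (conn (zeros (I `|` [set p - q])) (zeros (I `|` [set t]))).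
- by exists (I `|` [set p - q]).
- by exists (I `|` [set t]).
- apply/seteqP; split=> B; last by case=> /ZU [].
  move=> EB; have [_ /eqP] := xy _ EB; rewrite -subr_eq0 subrXX mulf_eq0.
  case/orP => /eqP e; [left|right]; apply/ZU; split=> //; last by rewrite tE.
  by rewrite mpoly.mevalB pE qE.
(* Where x = y the cofactor equals m x^(m-1), which is nonzero in characteristic zero. *)
- rewrite -subset0 => B [/ZU[EB +] /ZU[_ +]].
  rewrite mpoly.mevalB pE qE tE => /subr0_eq xyB.
  rewrite /x /y xyB -/(y B); under eq_bigr => k _.
    rewrite -exprD subnK; last by rewrite -ltnS prednK.
    over.
  move/eqP; rewrite sumr_const card_ord -mulr_natr mulf_eq0 pnatr_eq0 gtn_eqF //.
  rewrite orbF expf_eq0 => /andP[_].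
  by rewrite /y -xyB (negPf (proj1 (xy _ EB))).
- rewrite -subset0 => /(_ A0) []; apply/ZU; split=> //.
  by rewrite mpoly.mevalB pE qE; apply/eqP; rewrite subr_eq0; apply/eqP.
- move=> Z2; apply/eqP; rewrite -subr_eq0; apply: contraT => xyA.
  have : zeros (I `|` [set t]) A; last by rewrite Z2.
  apply/ZU; split=> //; have [_ /eqP] := xy _ EA.
  by rewrite -subr_eq0 subrXX mulf_eq0 (negPf xyA) tE => /eqP.
Qed.

(* The set [V] of the proof is the rational span of the characters trivial on the
   group, and the cocharacter [y] separates x_i / x_j from it; by connectedness
   x_i / x_j is not in [V]. *)
Lemma diagonal_group_cocharacter (K : numFieldType) n
    (F : set (entry_poly n rat)) (P s : 'M[K]_n) (i j : 'I_n) :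
  P \in unitmx -> group_set (points K F) -> zariski_connected (points K F) ->
  (forall A, points K F A -> is_diag_mx (Ad P A)) ->
  points K F s -> Ad P s i i != Ad P s j j ->
  exists2 y : 'cV[rat]_n, y i 0 != y j 0 &
    forall z : 'rV[K]_n,
      (forall a b : mpoly.multinom n,
        \sum_k (mpoly.fun_of_multinom a k)%:R * y k 0 =
        \sum_k (mpoly.fun_of_multinom b k)%:R * y k 0 ->
        monomial a z = monomial b z) ->
      points K F (invmx P *m diag_mx z *m P).
Proof.
move=> PU [FU F1 FM FV] Fconn Fdiag Fs sij.
pose Q := invmx P.
pose H := [set d : 'rV[K]_n | points K F (Q *m diag_mx d *m P)].
have H1 : H (const_mx 1) by rewrite /H /= diag_const_mx mulmx1 mulVmx.
have HM d e : H d -> H e -> H (\row_k (d 0 k * e 0 k)).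
  move=> Hd He; rewrite /H /= -mulmx_diag.
  have -> : Q *m (diag_mx d *m diag_mx e) *m P =
    (Q *m diag_mx d *m P) *m (Q *m diag_mx e *m P) by rewrite !mulmxA mulmxK.
  exact: FM.
have H0 d k : H d -> d 0 k != 0.
  move=> /FU /=; rewrite !unitmx_mul => /andP[/andP[_ +] _].
  rewrite unitmxE unitfE det_diag (bigD1 k) //= mulf_eq0 negb_or.
  by case/andP.
have FH A : points K F A -> exists2 d, H d & P *m A *m Q = diag_mx d.
  move=> FA; have /diag_mxP[d dE] := Fdiag _ FA; exists d; last by rewrite -dE.
  by rewrite /H /= -dE /Ad !mulmxA mulVmx // mul1mx -mulmxA mulVmx // mulmx1.
(* [N] clears the denominators of [l], so that the exponents [k] define a genuine character. *)
pose V := [set l : 'rV[rat]_n | exists2 N : int, N != 0 &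
  exists2 k : 'I_n -> int, forall a, N%:~R * l 0 a = (k a)%:~R &
    forall d, H d -> \prod_a d 0 a ^ k a = 1].
have V0 : V 0.
  exists 1 => //; exists (fun=> 0) => [a|d _]; first by rewrite mxE mulr0.
  by rewrite big1 // => a _; rewrite expr0z.
have VL a u w : V u -> V w -> V (a *: u + w).
  move=> [N1 N10 [k1 k1E k1H]] [N2 N20 [k2 k2E k2H]].
  exists (denq a * N1 * N2); first by rewrite !mulf_neq0 ?denq_neq0.
  exists (fun l => numq a * N2 * k1 l + denq a * N1 * k2 l) => [l|d Hd].
    rewrite !mxE rmorphD !rmorphM /= -k1E -k2E.
    rewrite numqE.
    ring.
  under eq_bigr => l _ do
    rewrite expfzDr ?H0 // ![_ * k1 l]mulrC ![_ * k2 l]mulrC -!exprz_exp.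
  rewrite big_split /=.
  have pw (f : 'I_n -> K) N : \prod_l f l ^ N = (\prod_l f l) ^ N.
    elim/big_rec2: _ => [|l y1 y2 _ ->]; first by rewrite exp1rz.
    by rewrite expfzMl.
  by rewrite !pw k1H // k2H // !exp1rz mulr1.
pose x : 'rV[rat]_n := delta_mx 0 i - delta_mx 0 j.
have ij : i != j by apply: contra sij => /eqP ->.
(* Otherwise some power of x_i / x_j is trivial on the group; connectedness then makes x_i and x_j
   equal, against the choice of [s]. *)
have Vx : ~ V x.
  move=> [N N0 [k kE kH]].
  pose m := absz N; have m0 : (0 < m)%N by rewrite absz_gt0.
  have kl l : k l = N * ((l == i)%:R - (l == j)%:R).
    by apply/eqP; rewrite -(eqr_int rat) -kE !mxE !rmorphM rmorphB /= !natz.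
  have Hm d : H d -> d 0 i ^+ m = d 0 j ^+ m.
    move=> Hd; have di := H0 _ i Hd; have dj := H0 _ j Hd.
    have /eqP := kH _ Hd; rewrite (bigD1 i) // (bigD1 j) 1?eq_sym //= !kl.
    rewrite !eqxx (eq_sym j i) (negPf ij) subr0 sub0r mulr1 mulrN1.
    rewrite big1 ?mulr1; last first.
      by move=> l /andP[/negPf li /negPf lj]; rewrite kl li lj subrr mulr0 expr0z.
    rewrite -invr_expz => /eqP.
    move=> /esym/divr1_eq; rewrite /m.
    by case: (N) => r //=; rewrite !NegzE -!invr_expz => /invr_inj.
  move: sij; apply/negP; rewrite negbK; apply/eqP.
  apply: (@zariski_connected_torsion_free K n F P Q i j m) Fs => //.
    move=> A /FH[d Hd dE]; rewrite dE !mxE !eqxx !mulr1n; split; first exact: H0.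
    exact: Hm.
  by exists 1%:M => //; rewrite mulmx1 mulmxV // !mxE !eqxx.
have [y yV xy] := linear_separation V0 VL Vx.
exists y; first move: xy.
  apply: contra => /eqP yij; apply/eqP/matrixP => a b; rewrite !ord1 mulmxBl.
  by rewrite -!rowE !mxE yij subrr.
move=> z zP; apply: (@diagonal_group_relations K n F P Q _ H1 HM) => a b ab.
apply: zP.
(* If the monomials [a] and [b] agree on [H], then a - b lies in [V] and is killed by [y]: both have
   the same [y]-weight. *)
pose l : 'rV[rat]_n := \row_k ((mpoly.fun_of_multinom a k)%:R -
   (mpoly.fun_of_multinom b k)%:R).
have : V l.
  exists 1 => //; exists (fun k => (mpoly.fun_of_multinom a k)%:Z -
    (mpoly.fun_of_multinom b k)%:Z) => [k|d Hd].
    by rewrite mxE mul1r rmorphB.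
  under eq_bigr => k _ do rewrite expfzDr ?H0 // -invr_expz.
  rewrite big_split /= prodfV -/(monomial a d) -/(monomial b d) -(ab _ Hd) divff //.
  by apply/prodf_neq0 => k _; rewrite expf_neq0 // H0.
move=> /yV /matrixP /(_ 0 0); rewrite !mxE => /eqP.
rewrite (eq_bigr (fun k => (mpoly.fun_of_multinom a k)%:R * y k 0 -
  (mpoly.fun_of_multinom b k)%:R * y k 0)) => [|k _]; last by rewrite mxE mulrBl.
by rewrite sumrB subr_eq0 => /eqP.
Qed.

Lemma map_Ad (K L : fieldType) (f : {rmorphism K -> L}) n (A B : 'M[K]_n) :
  map_mx f (Ad A B) = Ad (map_mx f A) (map_mx f B).
Proof. by rewrite /Ad !map_mxM map_invmx. Qed.

(** Connectedness concerns the complex points, so [y] is found there; the point exp(y) is real and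
    descends. A monomial takes at exp(y) the exponential of its [y]-weight, so monomials of equal
    weight agree there, even for nonintegral [y]. *)
Lemma split_torus_one_parameter (R : realType) n (F : set (entry_poly n rat))
    (P : 'M[rat]_n) (s : 'M[R]_n) (i j : 'I_n) :
  P \in unitmx -> Q_group R F -> zariski_connected (complex_points R F) ->
  (forall A, complex_points R F A -> is_diag_mx (Ad (map_mx ratr P) A)) ->
  real_points R F s ->
  Ad (map_mx ratr P) s i i != Ad (map_mx ratr P) s j j ->
  exists2 y : 'cV[rat]_n, y i 0 != y j 0 &
    real_points R F (invmx (map_mx ratr P) *m
      diag_mx (\row_k expR (ratr (y k 0))) *m map_mx ratr P).
Proof.
move=> PU [Fgrp _] Fconn Fdiag Fs sij.
pose rc : {rmorphism R -> R[i]} := real_complex R.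
pose PR : 'M[R]_n := map_mx ratr P.
have PE : map_mx ratr P = map_mx rc PR.
  by apply/matrixP => a b; rewrite !mxE fmorph_rat.
have [||||y yij yF] := @diagonal_group_cocharacter _ n F (map_mx rc PR)
    (map_mx rc s) i j _ Fgrp Fconn.
- by rewrite -PE map_unitmx.
- by move=> A /Fdiag; rewrite PE.
- exact/points_map.
- by rewrite -map_Ad [_ i i]mxE [_ j j]mxE fmorph_eq.
exists y => //; apply/(points_map rc).
have -> : map_mx rc (invmx (map_mx ratr P) *m
      diag_mx (\row_k expR (ratr (y k 0))) *m map_mx ratr P) =
    invmx (map_mx rc PR) *m diag_mx (\row_k rc (expR (ratr (y k 0)))) *m
    map_mx rc PR.
  rewrite !map_mxM map_invmx map_diag_mx.
  by congr (_ *m diag_mx _ *m _); apply/matrixP => a k; rewrite !mxE.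
apply: yF => a b ab.
have mE c : monomial c (\row_k rc (expR (ratr (y k 0)))) =
    rc (expR (ratr (\sum_k (mpoly.fun_of_multinom c k)%:R * y k 0))).
  rewrite rmorph_sum /= expR_sum rmorph_prod; apply: eq_bigr => k _.
  by rewrite mxE -rmorphXn -expRM_natl -(ratr_nat R) -rmorphM.
by rewrite !mE ab.
Qed.

(** * Integral eigenvectors of a one-parameter subgroup *)

Lemma integral_multiple n (r : 'rV[rat]_n) :
  exists2 q : int, q != 0 & exists e : 'rV[int]_n, map_mx intr e = q%:~R *: r.
Proof.
exists (\prod_k denq (r 0 k)); first by apply/prodf_neq0 => k _; exact: denq_neq0.
exists (\row_k (numq (r 0 k) * \prod_(l | l != k) denq (r 0 l))).
apply/rowP => k; rewrite !mxE [in RHS](bigD1 k) //= !intrM numqE; ring.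
Qed.

(** In the eigenbasis, the commutation relation fixes the weight difference y_a - y_b at every
    nonzero entry (a, b) of [w]. A row of extremal weight on the right side is therefore zero, and
    [e] is an integral multiple of the corresponding row of [P]. *)
Lemma contracted_integral_row (R : realType) n (P : 'M[rat]_n) (y : 'cV[rat]_n)
    (w : 'M[R]_n) (c : R) (i j : 'I_n) :
  let PR : 'M[R]_n := map_mx ratr P in
  let s := invmx PR *m diag_mx (\row_k expR (ratr (y k 0))) *m PR in
  P \in unitmx -> \det s = 1 -> y i 0 != y j 0 ->
  Ad PR w i j != 0 -> s *m w = c *: (w *m s) ->
  exists2 e : 'rV[int]_n, e != 0 & exists l : R,
    [/\ 0 < l, l != 1, map_mx intr e *m w = 0 &
        map_mx intr e *m s = l *: map_mx intr e].
Proof.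
move=> PR s PU dets yij wij sw.
pose d : 'rV[R]_n := \row_k expR (ratr (y k 0)).
have PRU : PR \in unitmx by rewrite map_unitmx.
have Ps : PR *m s = diag_mx d *m PR by rewrite /s !mulmxA mulmxV // mul1mx.
have dw : diag_mx d *m Ad PR w = c *: (Ad PR w *m diag_mx d).
  have -> : Ad PR w *m diag_mx d = PR *m (w *m s) *m invmx PR.
    by rewrite /Ad /s !mulmxA mulmxK.
  rewrite /Ad !mulmxA -Ps -(mulmxA PR s) sw.
  by rewrite -scalemxAr -scalemxAl !mulmxA.
have rel a b : Ad PR w a b != 0 -> expR (ratr (y a 0)) = c * expR (ratr (y b 0)).
  move: (Ad PR w) dw => W /matrixP/(_ a b); rewrite mul_diag_mx mul_mx_diag !mxE.
  by rewrite mulrC [RHS]mulrCA => e /mulfI; apply.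
have yrel a b : Ad PR w a b != 0 -> y a 0 - y b 0 = y i 0 - y j 0.
  move=> wab; have ra := rel _ _ wab; have ri := rel _ _ wij.
  apply: (fmorph_inj (@ratr R)); apply: expR_inj.
  rewrite !rmorphB !expRB ra ri -!mulrA !divff ?gt_eqF ?expR_gt0 //.
have sumy : \sum_k y k 0 = 0.
  apply: (fmorph_inj (@ratr R)); apply: expR_inj; rewrite rmorph0 expR0.
  rewrite rmorph_sum expR_sum -[RHS]dets !det_mulmx det_diag mulrAC -det_mulmx.
  by rewrite mulVmx // det1 mul1r; apply: eq_bigr => k _; rewrite mxE.
have [a ya0 rowa] : exists2 a, y a 0 != 0 & forall b, Ad PR w a b = 0.
  (* The weights sum to 0, so an extremal weight equal to 0 would make all of them 0, whereas y_i
     and y_j differ. *)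
  have nz a : (forall b, y a 0 <= y b 0) \/ (forall b, y b 0 <= y a 0) -> y a 0 != 0.
    move=> ext; apply: contra yij => /eqP ya0.
    have y0 : forall b, y b 0 = 0.
      case: ext => ext b; rewrite ya0 in ext.
        by apply: (psumr_eq0P _ sumy).
      apply/eqP; rewrite -oppr_eq0; apply/eqP.
      apply: (psumr_eq0P (P := xpredT) (F := fun k => - y k 0)) => // [k _|].
        by rewrite oppr_ge0.
      by rewrite sumrN sumy oppr0.
    by rewrite !y0.
  (* If y_i < y_j, a nonzero entry (a, b) needs y_a < y_b, which is impossible for maximal y_a; in
     the other case y_a is minimal. *)
  case: (ltgtP (y i 0) (y j 0)) yij => // ltij _.
    have [a amax] : exists a, forall b, y b 0 <= y a 0.
      case: (arg_maxP (fun k => y k 0) (erefl (xpredT i))) => a _ am.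
      by exists a => b; exact: am.
    exists a; first by apply: nz; right.
    move=> b; apply/eqP; apply: contraT => /yrel e; have := amax b; lra.
  have [a amin] : exists a, forall b, y a 0 <= y b 0.
    case: (arg_minP (fun k => y k 0) (erefl (xpredT i))) => a _ am.
    by exists a => b; exact: am.
  exists a; first by apply: nz; left.
  move=> b; apply/eqP; apply: contraT => /yrel e; have := amin b; lra.
have [q q0 [e eE]] := integral_multiple (row a P).
have eR : map_mx intr e = (q%:~R : R) *: row a PR.
  apply/rowP => k; have /rowP/(_ k) := eE; rewrite !mxE => /(congr1 (@ratr R)).
  by rewrite rmorphM /= !ratr_int.
exists e.
  apply/eqP => e0; move/eqP: eE; rewrite e0 map_mx0 eq_sym scaler_eq0 intr_eq0.
  rewrite (negPf q0) /= => /eqP rP.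
  have : row a P *m invmx P = delta_mx 0 a by rewrite -row_mul mulmxV // row1.
  rewrite rP mul0mx => /rowP/(_ a); rewrite !mxE !eqxx => /eqP.
  by rewrite eq_sym oner_eq0.
exists (expR (ratr (y a 0))); split.
- exact: expR_gt0.
- apply: contra ya0 => /eqP; rewrite -expR0 => /expR_inj /eqP.
  by rewrite fmorph_eq0.
- rewrite eR -scalemxAl -row_mul.
  have -> : PR *m w = Ad PR w *m PR by rewrite /Ad mulmxKV.
  rewrite row_mul; have -> : row a (Ad PR w) = 0.
    by apply/rowP => b; rewrite mxE rowa mxE.
  by rewrite mul0mx scaler0.
- rewrite eR -scalemxAl -row_mul Ps mul_diag_mx scalerA mulrC -scalerA.
  by congr (_ *: _); apply/rowP => k; rewrite !mxE.
Qed.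

(** * Distance functions on the homogeneous space *)

Section MatrixNorm.
Variable R : realType.

Lemma mx_entry_le_norm m n (A : 'M[R]_(m, n)) i j : `|A i j| <= `|A|.
Proof.
by rewrite [leRHS]/Num.norm /= mx_normrE; apply/bigmax_geP; right; exists (i, j).
Qed.

Lemma mx_norm_le m n (A : 'M[R]_(m, n)) x :
  0 <= x -> (forall i j, `|A i j| <= x) -> `|A| <= x.
Proof.
move=> x0 Ax; rewrite [leLHS]/Num.norm /= mx_normrE.
by apply/bigmax_leP; split=> // -[i j] _; exact: Ax.
Qed.

Lemma mx_norm_mulmx m n p (A : 'M[R]_(m, n)) (B : 'M[R]_(n, p)) :
  `|A *m B| <= n%:R * (`|A| * `|B|).
Proof.
apply: mx_norm_le => [|i j]; first by rewrite !mulr_ge0.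
rewrite mxE (le_trans (ler_norm_sum _ _ _)) //.
have -> : n%:R * (`|A| * `|B|) = \sum_(k < n) `|A| * `|B|.
  by rewrite sumr_const card_ord mulr_natl.
by apply: ler_sum => k _; rewrite normrM ler_pM // mx_entry_le_norm.
Qed.

Lemma mulmxr_continuous m n p (B : 'M[R]_(n, p)) :
  continuous (fun A : 'M[R]_(m, n) => A *m B).
Proof.
move=> A; apply/(@cvgrPdist_lt _ _ _ _ (nbhs_filter A)) => eps eps0.
pose K := n%:R * `|B| + 1.
have K0 : 0 < K by rewrite ltr_pwDr // mulr_ge0.
near=> A'; rewrite -mulmxBl (le_lt_trans (mx_norm_mulmx _ _)) // mulrCA.
apply: (@le_lt_trans _ _ (`|A - A'| * K)); first by rewrite ler_wpM2l // lerDl.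
rewrite -ltr_pdivlMr //; near: A'.
apply: (@cvgr_dist_lt _ _ _ (nbhs A) (nbhs_filter A) id A cvg_id).
exact: divr_gt0.
Unshelve. all: by end_near. Qed.

Lemma ler_dist_inf (T : Type) (D : set T) (a b : T -> R) (x : R) :
  D !=set0 -> (forall t, 0 <= a t) -> (forall t, 0 <= b t) ->
  (forall t, D t -> `|a t - b t| <= x) ->
  `|inf [set a t | t in D] - inf [set b t | t in D]| <= x.
Proof.
move=> [t0 Dt0] a0 b0 ab.
have main (f g : T -> R) : (forall t, 0 <= f t) ->
    (forall t, D t -> f t - g t <= x) ->
    inf [set f t | t in D] - inf [set g t | t in D] <= x.
  move=> f0 fg; rewrite lerBlDr -lerBlDl; apply: lb_le_inf.
    by exists (g t0), t0.
  move=> _ [t Dt <-]; rewrite lerBlDl; apply: (@le_trans _ _ (f t)).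
    by apply: ge_inf; [exists 0 => _ [u _ <-]|exists t].
  by have := fg _ Dt; rewrite lerBlDr.
rewrite ler_norml lerNl opprB !main //.
- by move=> t /ab; rewrite ler_norml => /andP[_].
- by move=> t /ab; rewrite distrC ler_norml => /andP[_].
Qed.

Lemma ler_dist_min1 (a b : R) : `|Num.min 1 a - Num.min 1 b| <= `|a - b|.
Proof.
wlog ab : a b / a <= b => [H|].
  by case/orP: (le_total a b) => /H //; rewrite distrC [leRHS]distrC.
rewrite [leRHS]distrC [leLHS]distrC !ger0_norm ?subr_ge0 //.
  by rewrite /Order.min; case: ltP => ?; case: ltP => ?; lra.
by rewrite le_min !ge_min lexx ab orbT.
Qed.

(** The bound is uniform in [u]: for bounded [u] the perturbation is at most a multiple of the
    distance from [A] to 1, and for large [u] both distances are truncated to 1. *)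
Lemma truncated_dist_mulmx n (p u : 'rV[R]_n) (A : 'M[R]_n) :
  n%:R * `|A - 1%:M| <= 2^-1 ->
  `|Num.min 1 `|u - p| - Num.min 1 `|u *m A - p| | <=
    2 * (`|p| + 1) * (n%:R * `|A - 1%:M|).
Proof.
move=> A1; set t := n%:R * _ in A1 *.
have t0 : 0 <= t by rewrite mulr_ge0.
have uA : `|u *m A - u| <= `|u| * t.
  have -> : u *m A - u = u *m (A - 1%:M) by rewrite mulmxBr mulmx1.
  by rewrite (le_trans (mx_norm_mulmx _ _)) // mulrCA.
(* Beyond this threshold, as t is at most 1/2, the norm of u A - p is at least |u|/2 - |p|, hence
   above 1. *)
have [uM|uM] := leP `|u| (2 * (`|p| + 1)).
  have h : `| `|u - p| - `|u *m A - p| | <= 2 * (`|p| + 1) * t.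
    apply: (le_trans (ler_dist_dist _ _)).
    have -> : u - p - (u *m A - p) = - (u *m A - u).
      by rewrite opprB addrA subrK opprB.
    by rewrite normrN (le_trans uA) // ler_wpM2r.
  exact: le_trans (ler_dist_min1 _ _) h.
have p0 : 0 <= `|p| by [].
have nu : `|u| - `|p| <= `|u - p| := lerB_dist _ _.
have nuA : `|u| - `|u *m A - u| - `|p| <= `|u *m A - p|.
  apply: (le_trans _ (lerB_dist _ _)); rewrite lerD2r.
  by apply: (le_trans (lerB_normD _ _)); rewrite addrC subrK.
have ut : `|u| * t <= `|u| * 2^-1 by rewrite ler_wpM2l.
rewrite !min_l ?subrr ?normr0 ?mulr_ge0 //; lra.
Qed.

End MatrixNorm.

Section OrbitDistance.
Variables (R : realType) (n : nat) (G Gamma : mxgroup R n).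

Lemma mx_of_continuous : continuous (@mx_of R n G).
Proof. exact: initial_continuous. Qed.

Lemma mx_of_unit (g : elt G) : mx_of g \in unitmx.
Proof. by case: (mxgroupP G) => GU _ _ _; apply: GU; exact: mx_ofP. Qed.

Lemma coset_eqP (g h : elt G) :
  coset Gamma g = coset Gamma h <->
  exists2 c, mxgroup_set Gamma c & mx_of h = c *m mx_of g.
Proof.
split=> [/eqquotP/asboolP //|E].
by apply/eqquotP/asboolP.
Qed.

Lemma coset_reprK (x : homspace G Gamma) : coset Gamma (coset_repr x) = x.
Proof. exact: reprK. Qed.

Lemma coset_continuous : continuous (coset Gamma : elt G -> homspace G Gamma).
Proof. exact: pi_continuous. Qed.

Lemma coset_rtrans (g h : elt G) :
  rtrans g (coset Gamma h) = coset Gamma (mul_elt h g).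
Proof.
have [c Gc hE] := (coset_eqP _ _).1 (coset_reprK (coset Gamma h)).
by apply/coset_eqP; exists c => //=; rewrite hE mulmxA.
Qed.

Lemma mul_elt_continuous (g : elt G) : continuous (fun h : elt G => mul_elt h g).
Proof.
apply: continuous_comp_initial => h.
apply: (@continuous_comp _ _ _ (@mx_of R n G) (mulmx^~ (mx_of g))).
  exact: mx_of_continuous.
exact: mulmxr_continuous.
Qed.

Lemma rtrans_continuous (g : elt G) :
  continuous (rtrans g : homspace G Gamma -> homspace G Gamma).
Proof.
apply/quotient_continuous.
change (continuous (rtrans g \o coset Gamma)).
have -> : rtrans g \o coset Gamma =
    coset Gamma \o (fun h => mul_elt h g).
  by apply: funext => h; exact: coset_rtrans.
move=> h; apply: continuous_comp; first exact: mul_elt_continuous.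
exact: coset_continuous.
Qed.

Variables e p : 'rV[R]_n.

Let truncated (g : elt G) (c : 'M[R]_n) := Num.min 1 `|e *m c *m mx_of g - p|.

(** It vanishes exactly when [p] is in the closure of e Gamma g. Truncation at 1 makes it a bounded
    test function and gives a modulus of continuity uniform over [Gamma]. *)
Definition orbit_distance (g : elt G) : R :=
  inf [set truncated g c | c in mxgroup_set Gamma].

Let truncated_ge0 g c : 0 <= truncated g c.
Proof. by rewrite le_min ler01 normr_ge0. Qed.

Lemma orbit_distance_ge0 g : 0 <= orbit_distance g.
Proof.
apply: lb_le_inf => [|_ [c _ <-]]; last exact: truncated_ge0.
by exists (truncated g 1%:M), 1%:M => //; exact: group_one.
Qed.

Lemma orbit_distance_le g c :
  mxgroup_set Gamma c -> orbit_distance g <= truncated g c.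
Proof.
by move=> Gc; apply: ge_inf; [exists 0 => _ [d _ <-]; exact: truncated_ge0|exists c].
Qed.

Lemma orbit_distance_le1 g : orbit_distance g <= 1.
Proof.
by apply: le_trans (orbit_distance_le g (group_one Gamma)) _; rewrite ge_min lexx.
Qed.

Lemma orbit_distance_eq0 g eps : orbit_distance g = 0 -> 0 < eps ->
  exists2 c, mxgroup_set Gamma c & `|e *m c *m mx_of g - p| < eps.
Proof.
move=> g0 eps0; have eps1 : 0 < Num.min 1 eps by rewrite lt_min ltr01.
have [|_ [c Gc <-]] :=
  @inf_adherent R [set truncated g c | c in mxgroup_set Gamma] _ eps1.
  split; first by exists (truncated g 1%:M), 1%:M => //; exact: group_one.
  by exists 0 => _ [d _ <-]; exact: truncated_ge0.
rewrite -/(orbit_distance g) g0 add0r => h; exists c => //; move: h.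
by rewrite /truncated lt_min !gt_min ltxx /= => /andP[a1 /orP[/(lt_trans a1)|]].
Qed.

Lemma orbit_distance_coset g h :
  coset Gamma g = coset Gamma h -> orbit_distance g = orbit_distance h.
Proof.
have sub (g1 g2 : elt G) : coset Gamma g1 = coset Gamma g2 ->
    [set truncated g1 c | c in mxgroup_set Gamma] `<=`
    [set truncated g2 c | c in mxgroup_set Gamma].
  move=> /esym/coset_eqP[c Gc gE] _ [d Gd <-]; exists (d *m c).
    by case: (mxgroupP Gamma) => _ _ GM _; exact: GM.
  by rewrite /truncated gE !mulmxA.
by move=> gh; congr inf; apply/seteqP; split; exact: sub.
Qed.

(** Writing h = g A with A close to 1, the uniform bound on truncated distances passes to the
    infimum over [Gamma]. *)
Lemma orbit_distance_continuous : continuous orbit_distance.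
Proof.
move=> g; apply/(@cvgrPdist_le _ _ _ _ (nbhs_filter g)) => eps eps0.
pose K := 2 * (`|p| + 1).
have K0 : 0 < K by rewrite mulr_gt0 // ltr_pwDr.
(* [L] controls the distance from g^-1 h to 1 by that from [h] to [g]; the added 1 makes it
   positive. *)
pose L := n%:R * (n%:R * `|invmx (mx_of g)|) + 1.
have L0 : 0 < L by rewrite ltr_pwDr // !mulr_ge0.
pose del := Num.min (2^-1) (eps / K).
have del0 : 0 < del by rewrite lt_min invr_gt0 ltr0n divr_gt0.
have /(@cvgrPdist_lt _ _ _ _ (nbhs_filter g))/(_ (del / L)) := @mx_of_continuous g.
move=> /(_ (divr_gt0 del0 L0)); apply: filterS => h /= gh.
have Adel : n%:R * `|invmx (mx_of g) *m mx_of h - 1%:M| <= del.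
  rewrite -(mulVmx (mx_of_unit g)) -mulmxBr distrC in gh *.
  apply: (@le_trans _ _
    (n%:R * (n%:R * (`|invmx (mx_of g)| * `|mx_of h - mx_of g|)))).
    by rewrite ler_wpM2l // mx_norm_mulmx.
  apply: (@le_trans _ _ (L * `|mx_of h - mx_of g|)).
    by rewrite !mulrA ler_wpM2r // -mulrA lerDl.
  by rewrite mulrC -ler_pdivlMr // ltW.
apply: ler_dist_inf => [||| c Gc] //.
  by exists 1%:M; exact: group_one.
rewrite /truncated; have -> : e *m c *m mx_of h =
    e *m c *m mx_of g *m (invmx (mx_of g) *m mx_of h).
  by rewrite !mulmxA mulmxK // mx_of_unit.
apply: (le_trans (truncated_dist_mulmx _ _ _)).
  by rewrite (le_trans Adel) // ge_min lexx.
rewrite -/K mulrC -ler_pdivlMr // (le_trans Adel) // ge_min lexx orbT //.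
Qed.

Definition homspace_distance (x : homspace G Gamma) : R :=
  orbit_distance (coset_repr x).

Lemma homspace_distance_coset g :
  homspace_distance (coset Gamma g) = orbit_distance g.
Proof. by apply: orbit_distance_coset; exact: coset_reprK. Qed.

Lemma homspace_distance_continuous : continuous homspace_distance.
Proof.
apply/quotient_continuous.
change (continuous (homspace_distance \o coset Gamma)).
have -> : homspace_distance \o coset Gamma =
    orbit_distance.
  by apply: funext => h; exact: homspace_distance_coset.
exact: orbit_distance_continuous.
Qed.

End OrbitDistance.

(** * Equidistribution, null sets and translates *)

Section Equidistribution.
Variables (R : realType) (n : nat) (G Gamma : mxgroup R n).
Variable nu : probability (borel_homspace G Gamma) R.
Implicit Type f : homspace G Gamma -> R.

Lemma open_borel_homspace (A : set (homspace G Gamma)) :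
  open A -> measurable (A : set (borel_homspace G Gamma)).
Proof. by move=> oA; exact: sub_sigma_algebra. Qed.

Lemma continuous_borel_homspace f :
  continuous f -> measurable_fun [set: borel_homspace G Gamma] f.
Proof.
move=> /continuousP cf; apply: (measurability _ (RGenOpens.measurableE R)).
move=> _ [_ [a [b ->] <-]]; rewrite setTI; apply: open_borel_homspace.
exact/cf/interval_open.
Qed.

Lemma zero_Rintegral_null f : continuous f -> (forall x, 0 <= f x <= 1) ->
  \int[nu]_x f x = 0 -> nu [set x | f x != 0] = 0%E.
Proof.
move=> cf f01 intf.
have mf : measurable_fun [set: borel_homspace G Gamma]
    (EFin \o (f : borel_homspace G Gamma -> R)).
  by apply/measurable_EFinP; exact: continuous_borel_homspace.
have mA : measurable ([set x | f x != 0] : set (borel_homspace G Gamma)).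
  apply: open_borel_homspace.
  have -> : [set x | f x != 0] = f @^-1` [set~ 0].
    by apply/seteqP; split=> x /eqP.
  by apply: open_comp => [x _|]; [exact: cf|exact/closed_openC/closed_eq].
(* [Rintegral] sends an infinite integral to 0, so finiteness is established before the extended
   integral is concluded to vanish. *)
have int1 : (\int[nu]_x (f x)%:E <= 1)%E.
  rewrite -(@probability_setT _ _ _ nu) -[X in (_ <= X)%E]mul1e.
  rewrite -(integral_cst _ measurableT); apply: ge0_le_integral => //.
  - by move=> x _; case/andP: (f01 x); rewrite lee_fin.
  - by move=> x _; case/andP: (f01 x); rewrite lee_fin.
have int0 : (\int[nu]_x (f x)%:E = 0)%E.
  move: intf int1; rewrite /Rintegral.
  have : (0 <= \int[nu]_x (f x)%:E)%E.
    by apply: integral_ge0 => x _; case/andP: (f01 x); rewrite lee_fin.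
  by case: (\int[nu]_x (f x)%:E)%E => [r|//|//] /= _ ->.
have : (\int[nu]_x `|(EFin \o (f : borel_homspace G Gamma -> R)) x|)%E = 0%E.
  rewrite -int0; apply: eq_integral => x _ /=.
  by rewrite ger0_norm //; case/andP: (f01 x).
move=> /(ae_eq_integral_abs nu measurableT mf) /= [N [mN N0 sN]].
apply/eqP; rewrite -measure_le0 -N0; apply: le_measure; rewrite ?inE //.
move=> x /= fx; apply: sN => /= h; move/eqP: fx; apply.
by have [] := h Logic.I.
Qed.

(** The averages of [f] along the orbit are 0, hence so is its integral, and [f] vanishes off a null
    set. By invariance the countably many translates of this set are null, and they cannot cover a
    probability space. *)
Lemma equidistributed_translates f (v : 'M[R]_n) (Gv : lie_algebra G v)
    (x0 : homspace G Gamma) (g : nat -> elt G) :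
  invariant_measure nu -> orbit_equidistributed nu Gv x0 ->
  continuous f -> (forall x, 0 <= f x <= 1) ->
  (forall t, f (rtrans (Elt (Gv t)) x0) = 0) ->
  exists x, forall k, f (rtrans (g k) x) = 0.
Proof.
move=> inv equi cf f01 f0.
have bf : bounded_fun f.
  exists 1; split; first exact: num_real.
  move=> M M1 x _ /=; have /andP[fx0 fx1] := f01 x.
  by rewrite ger0_norm // (le_trans fx1) // ltW.
have intf : \int[nu]_x f x = 0.
  apply: (cvg_unique _ (equi f cf bf)) => //.
  have -> : (fun T : R => T^-1 *
      \int[lebesgue_measure]_(t in `[0, T]) f (rtrans (Elt (Gv t)) x0)) = cst 0.
    apply: funext => T; rewrite (_ : Rintegral _ _ _ = 0) ?mulr0 //.
    by rewrite /Rintegral integral0_eq //= => t _; rewrite f0.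
  exact: cvg_cst.
pose A := [set x : borel_homspace G Gamma | f x != 0].
have oA : open (A : set (homspace G Gamma)).
  have -> : A = f @^-1` [set~ 0] by apply/seteqP; split=> x /eqP.
  by apply: open_comp => [x _|]; [exact: cf|exact/closed_openC/closed_eq].
have A0 : nu A = 0%E by exact: zero_Rintegral_null.
pose B k := rtrans (g k) @^-1` A.
have mB k : measurable (B k : set (borel_homspace G Gamma)).
  apply: open_borel_homspace; apply: open_comp => // x _.
  exact: rtrans_continuous.
have B0 k : nu (B k) = 0%E.
  by rewrite inv //; exact: open_borel_homspace.
have : nu.-negligible (\bigcup_k B k).
  by apply: negligible_bigcup => k; apply/negligibleP; [exact: mB|exact: B0].
move=> [N [mN N0 BN]].
apply: contrapT => nex.
have BT : \bigcup_k B k = setT.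
  rewrite -subTset => x _; apply: contrapT => nB; apply: nex.
  exists x => k; apply/eqP; apply: contrapT => /negP fx; apply: nB.
  by exists k.
have NT : N = setT by rewrite -subTset -BT.
by move: N0; rewrite NT probability_setT => /eqP; rewrite onee_eq0.
Qed.

End Equidistribution.

(** * Integral rows fixed by the flow *)

Section FixedRow.
Variables (R : realType) (n : nat).

(** Nilpotency reduces the exponential to a finite sum, of which only the constant term does not
    kill [p]. *)
Lemma row_mul_expmx (p : 'rV[R]_n) (v : 'M[R]_n) (t : R) :
  (exists k, v ^+ k = 0) -> p *m v = 0 -> p *m expmx (t *: v) = p.
Proof.
move=> [k vk] pv.
pose u m : 'M[R]_n := (m`!%:R)^-1 *: (t *: v) ^+ m.
have u0 m : (k <= m)%N -> u m = 0.
  move=> km; rewrite /u (_ : _ ^+ m = t ^+ m *: v ^+ m).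
    by rewrite -(subnK km) (exprD v) vk mulr0 !scaler0.
  elim: m {km} => [|m IH]; first by rewrite !expr0 scale1r.
  by rewrite !exprS IH -!mulmxE -scalemxAl -scalemxAr scalerA.
(* The bound [k.+1], rather than [k], ensures that the term of index 0 is present to be split
   off. *)
have -> : expmx (t *: v) = series u k.+1.
  apply: cvg_lim; first exact: norm_hausdorff.
  apply: cvg_near_cst; exists k.+1 => // m /= km.
  rewrite /series /= (big_cat_nat (n := k.+1)) //= [X in _ + X]big_nat_cond.
  rewrite [X in _ + X]big1 ?addr0 // => i /andP[/andP[ki _] _].
  by apply: u0; exact: ltnW.
rewrite /series /= big_nat_recl // mulmxDr mulmx_sumr big1 ?addr0 => [|i _].
  by rewrite /u expr0 fact0 invr1 scale1r mulmx1.
by rewrite /u exprS -scalemxAr -mulmxE mulmxA -scalemxAr pv scaler0 mul0mx scaler0.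
Qed.

(** An element of [Gamma] is h c with [h] integral and [c] from a finite list. The row e h is
    integral and nonzero, hence of norm at least 1, and multiplication by [c] shrinks it by a
    bounded factor only. *)
Lemma commensurable_rows_away_from_0 (G Gamma : mxgroup R n) (e : 'rV[int]_n) :
  commensurable Gamma (integer_points G) -> e != 0 ->
  exists2 del : R, 0 < del &
    forall c, mxgroup_set Gamma c -> del <= `|map_mx intr e *m c|.
Proof.
move=> [[s Gs] _] e0.
(* A common bound for the norms of the inverses of all coset representatives. *)
pose S : R := \sum_(c <- s) `|invmx c|.
have S0 : 0 <= S by apply: sumr_ge0.
pose K := n%:R * S + 1.
have K0 : 0 < K by rewrite ltr_pwDr // mulr_ge0.
exists K^-1 => [|g Gg]; first by rewrite invr_gt0.
have [h [Gh [GGh [B _ hB]]] [c cs gE]] := Gs _ Gg.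
have Guni A : mxgroup_set Gamma A -> A \in unitmx.
  by case: (mxgroupP Gamma) => GU _ _ _; exact: GU.
have cU : c \in unitmx.
  have -> : c = invmx h *m g by rewrite -gE mulKmx // Guni.
  by rewrite unitmx_mul unitmx_inv !Guni.
pose z := e *m B.
have zE : map_mx intr e *m g = map_mx intr z *m c.
  by rewrite -gE -hB mulmxA map_mxM.
have z0 : z != 0.
  apply: contra e0 => /eqP z0.
  have eg : map_mx intr e *m g = 0 :> 'rV[R]_n by rewrite zE z0 map_mx0 mul0mx.
  have /rowP e1 : map_mx intr e = 0 :> 'rV[R]_n.
    by rewrite -(mulmxK (Guni _ Gg) (map_mx intr e)) eg mul0mx.
  apply/eqP/rowP => j; have := e1 j; rewrite !mxE => /eqP.
  by rewrite intr_eq0 => /eqP.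
have z1 : 1 <= `|map_mx intr z : 'rV[R]_n|.
  have /rV0Pn[j zj] := z0.
  apply: le_trans (mx_entry_le_norm _ 0 j); rewrite mxE -intr_norm.
  by rewrite ler1z -gtz0_ge1 normr_gt0.
rewrite -[X in X <= _]mul1r ler_pdivrMr // (le_trans z1) //.
have -> : map_mx intr z = map_mx intr e *m g *m invmx c :> 'rV[R]_n.
  by rewrite zE mulmxK.
apply: (le_trans (mx_norm_mulmx _ _)); rewrite mulrCA ler_wpM2l //.
apply: (@le_trans _ _ (n%:R * S)); last by rewrite lerDl.
rewrite ler_wpM2l // /S (big_rem c) //= lerDl.
by apply: sumr_ge0.
Qed.

End FixedRow.

Lemma expanded_row_not_equidistributed (R : realType) n (G Gamma : mxgroup R n)
    (nu : probability (borel_homspace G Gamma) R) (v : 'M[R]_n)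
    (Gv : lie_algebra G v) (xi tau : elt G) (e : 'rV[int]_n) (mu : R) :
  commensurable Gamma (integer_points G) -> invariant_measure nu ->
  orbit_equidistributed nu Gv (coset Gamma xi) -> (exists k, v ^+ k = 0) ->
  e != 0 -> map_mx intr e *m mx_of xi *m v = 0 ->
  1 < mu -> map_mx intr e *m mx_of tau = mu *: map_mx intr e -> False.
Proof.
move=> com inv equi vnil e0 ev mu1 etau.
pose eR : 'rV[R]_n := map_mx intr e.
pose p := eR *m mx_of xi.
pose f := homspace_distance (Gamma := Gamma) eR p : homspace G Gamma -> R.
(* The matrix of [g k] is tau^k xi. *)
pose g := fix g k := if k is k'.+1 then mul_elt tau (g k') else xi.
have mu0 : 0 < mu by apply: lt_trans mu1.
have eg k : eR *m mx_of (g k) = mu ^+ k *: p.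
  elim: k => [|k IH]; first by rewrite expr0 scale1r.
  by rewrite /= mulmxA etau -scalemxAl IH scalerA exprS.
(* The flow fixes [p], so the identity of [Gamma] already realizes distance 0 along the whole
   orbit. *)
have f0 t : f (rtrans (Elt (Gv t)) (coset Gamma xi)) = 0.
  rewrite coset_rtrans /f homspace_distance_coset; apply/eqP.
  rewrite eq_le orbit_distance_ge0 andbT.
  apply: (le_trans (orbit_distance_le _ _ _ (group_one Gamma))).
  rewrite mulmx1 /= mulmxA row_mul_expmx // subrr normr0 ge_min lexx orbT //.
have [x fx] := equidistributed_translates g inv equi
  (@homspace_distance_continuous R n G Gamma eR p)
  (fun x => introT andP
    (conj (orbit_distance_ge0 _ _ _ _) (orbit_distance_le1 _ _ _ _))) f0.
pose h := coset_repr x.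
have [del del0 Hdel] := commensurable_rows_away_from_0 com e0.
pose u := eR *m invmx (mx_of h).
(* By Bernoulli's inequality the powers of [mu] are unbounded; this [k] brings mu^-k u below del /
   2. *)
have [k uk] : exists k, `|u| < mu ^+ k * (del / 2).
  have bernoulli m : m%:R * (mu - 1) <= mu ^+ m.
    elim: m => [|m IH]; first by rewrite mul0r expr0.
    have : (mu - 1) * 1 <= (mu - 1) * mu ^+ m.
      by rewrite ler_pM2l ?subr_gt0 // exprn_ege1 // ltW.
    by rewrite exprS -natr1; move: IH; lra.
  pose y := `|u| / (del / 2) / (mu - 1).
  have y0 : 0 <= y by rewrite !divr_ge0 // ?subr_ge0 ltW.
  exists (Num.bound y); rewrite -ltr_pdivrMr ?divr_gt0 //.
  apply: lt_le_trans (bernoulli _); rewrite -ltr_pdivrMr ?subr_gt0 //.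
  exact: archi_boundP.
pose N := mul_elt h (g k).
pose K := n%:R * `|invmx (mx_of N)| + 1.
have K0 : 0 < K by rewrite ltr_pwDr // mulr_ge0.
have N0 : orbit_distance Gamma eR p N = 0.
  have := fx k; rewrite -(coset_reprK x) coset_rtrans -/h.
  by rewrite homspace_distance_coset.
(* The precision is chosen so that the error is still at most del / 2 after multiplication by the
   inverse of [N]. *)
have [|c Gc cN] := @orbit_distance_eq0 R n G Gamma eR p N (del / 2 / K) N0.
  by rewrite !divr_gt0.
have uN : u *m mx_of N = mu ^+ k *: p.
  by rewrite /u /= mulmxA mulmxKV ?mx_of_unit.
have muk : mu ^+ k != 0 by rewrite expf_neq0 // gt_eqF.
(* Since p N^-1 = mu^-k u, the row e c is a sum of two rows of norm at most del / 2, the second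
   strictly, against the lower bound [del]. *)
have cE : eR *m c = (eR *m c *m mx_of N - p) *m invmx (mx_of N) +
    (mu ^+ k)^-1 *: u.
  rewrite mulmxBl mulmxK ?mx_of_unit //.
  have -> : p = ((mu ^+ k)^-1 *: u) *m mx_of N.
    by rewrite -scalemxAl uN scalerA mulVf // scale1r.
  by rewrite mulmxK ?mx_of_unit // subrK.
have := Hdel _ Gc; apply/negP; rewrite -ltNge -/eR cE.
apply: (le_lt_trans (ler_normD _ _)); rewrite [X in _ < X](splitr del).
apply: ler_ltD.
  apply: (le_trans (mx_norm_mulmx _ _)); rewrite mulrCA.
  apply: (@le_trans _ _ (del / 2 / K * K)); last by rewrite divfK // gt_eqF.
  by rewrite ler_pM ?mulr_ge0 ?lerDl // ltW.
rewrite normrZ gtr0_norm ?invr_gt0 ?exprn_gt0 // mulrC.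
by rewrite ltr_pdivrMr ?exprn_gt0 // mulrC.
Qed.

(** * Real points of rational groups, and triviality of the character on split tori *)

Section RealPoints.
Variables (R : realType) (n : nat).

Lemma real_points_sub (E F : set (entry_poly n rat)) :
  complex_points R F `<=` complex_points R E -> real_points R F `<=` real_points R E.
Proof.
move=> FE A FA; apply/(points_map (real_complex R)); apply: FE.
exact/(points_map (real_complex R)).
Qed.

Lemma real_points_one (E : set (entry_poly n rat)) :
  Q_group R E -> real_points R E 1%:M.
Proof.
move=> [[_ E1 _ _] _]; apply/(points_map (real_complex R)).
by rewrite map_mx1.
Qed.

Lemma real_points_det (E : set (entry_poly n rat)) (A : 'M[R]_n) :
  Q_group R E -> real_points R E A -> \det A = 1.
Proof.
move=> [_ Edet] /(points_map (real_complex R)) /Edet /= detA.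
by apply: (fmorph_inj (real_complex R)); rewrite -det_map_mx detA rmorph1.
Qed.

Lemma real_points_diag (F : set (entry_poly n rat)) (P : 'M[rat]_n) (A : 'M[R]_n) :
  (forall B, complex_points R F B -> is_diag_mx (Ad (map_mx ratr P) B)) ->
  real_points R F A -> is_diag_mx (Ad (map_mx ratr P) A).
Proof.
move=> Fdiag /(points_map (real_complex R)) /Fdiag /is_diag_mxP Adiag.
apply/is_diag_mxP => i j /(Adiag i j) Aij; apply/eqP.
rewrite -(fmorph_eq0 (real_complex R)); apply/eqP; rewrite -[RHS]Aij.
have -> : map_mx ratr P = map_mx (real_complex R) (map_mx ratr P).
  by apply/matrixP => a b; rewrite !mxE fmorph_rat.
by rewrite -map_Ad [RHS]mxE.
Qed.

End RealPoints.

Theorem theorem3p5 (R : realType) (n : nat)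
    (E : set (entry_poly n rat))
    (EQ : Q_group R E)
    (Ess : connected_semisimple (complex_points R E))
    (G : mxgroup R n)
    (GE : mxgroup_set G = real_points R E)
    (Gnc : noncompact_type G)
    (Gfc : finite_set (center_set G))
    (Gamma : mxgroup R n)
    (Glat : lattice_in G Gamma)
    (Girr : irreducible_in G Gamma)
    (Gcom : commensurable Gamma (integer_points G))
    (nu : probability (borel_homspace G Gamma) R)
    (nuG : invariant_measure nu)
    (v : 'M[R]_n)
    (v_neq0 : v != 0)
    (v_nil : exists k, v ^+ k = 0)
    (Gv : lie_algebra G v)
    (xi : elt G)
    (xi_eq : orbit_equidistributed nu Gv (coset Gamma xi))
    (chi : 'M[R]_n -> R)
    (chiP : forall b,
       (Ad (mx_of xi) @` normalizer_set G (one_param_subgroup v)) b ->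
       chi b != 0 /\ Ad b (Ad (mx_of xi) v) = chi b *: Ad (mx_of xi) v)
    (F : set (entry_poly n rat))
    (Ftorus : Q_split_torus R F)
    (FE : complex_points R F `<=` complex_points R E)
    (FN : real_points R F `<=`
       Ad (mx_of xi) @` normalizer_set G (one_param_subgroup v)) :
  chi @` real_points R F = [set 1].
Proof.
have [FQ Fconn [P PU Fdiag]] := Ftorus.
set w := Ad (mx_of xi) v in chiP.
have xiU := mx_of_unit xi.
have wxi : w *m mx_of xi = mx_of xi *m v by rewrite /w /Ad mulmxKV.
have w0 : w != 0.
  apply: contra v_neq0 => /eqP w0; rewrite -(mulKmx xiU v) -wxi w0 mul0mx.
  by rewrite mulmx0.
have FG A : real_points R F A -> mxgroup_set G A.
  by move=> FA; rewrite GE; exact: real_points_sub FA.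
have FU A : real_points R F A -> A \in unitmx.
  by move=> FA; rewrite unitmxE (real_points_det FQ FA) unitr1.
have Fw A : real_points R F A -> A *m w = chi A *: (w *m A).
  move=> FA; have [_ Aw] := chiP _ (FN _ FA).
  by rewrite -[LHS](mulmxKV (FU _ FA)) -/(Ad A w) Aw -scalemxAl.
have F1 : real_points R F 1%:M by exact: real_points_one.
apply/seteqP; split=> [_ [s Fs <-]|_ ->]; last first.
  (* The value 1 is attained at the identity, because [w] is nonzero. *)
  exists 1%:M => //; have := Fw _ F1; rewrite mul1mx mulmx1.
  rewrite -[LHS]scale1r => /eqP; rewrite -subr_eq0 -scalerBl scaler_eq0.
  by rewrite (negPf w0) orbF subr_eq0 eq_sym => /eqP.
apply: contrapT => chis.
pose PR : 'M[R]_n := map_mx ratr P.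
have PRU : PR \in unitmx by rewrite map_unitmx.
have [i [j wij]] : exists i j, Ad PR w i j != 0.
  apply/matrix0Pn; apply: contra w0 => /eqP W0.
  have := mulmxKV PRU (PR *m w); rewrite -/(Ad PR w) W0 mul0mx => Pw.
  by rewrite -(mulKmx PRU w) -Pw mulmx0.
(* At the nonzero entry (i, j) of [w], the relation s w = chi(s) w s reads d_i = chi(s) d_j; equal
   eigenvalues would give chi(s) = 1. *)
have sij : Ad PR s i i != Ad PR s j j.
  have /diag_mxP[d dE] := real_points_diag Fdiag Fs.
  have dU : diag_mx d \in unitmx by rewrite -dE /Ad !unitmx_mul unitmx_inv PRU FU.
  have dj : d 0 j != 0.
    move: dU; rewrite unitmxE unitfE det_diag (bigD1 j) //= mulf_eq0 negb_or.
    by case/andP.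
  have AdM A B : Ad PR A *m Ad PR B = Ad PR (A *m B) by rewrite /Ad !mulmxA mulmxKV.
  have /matrixP/(_ i j) : diag_mx d *m Ad PR w = chi s *: (Ad PR w *m diag_mx d).
    by rewrite -dE -/PR !AdM Fw // /Ad -scalemxAr -scalemxAl.
  rewrite -/PR in dE; rewrite dE; move: (Ad PR w) wij => W Wij.
  rewrite mul_diag_mx mul_mx_diag !mxE !eqxx !mulr1n mulrC mulrCA => /(mulfI Wij).
  move=> dij; apply/eqP => dd; apply: chis.
  by move/eqP: dij; rewrite dd -{1}[d 0 j]mul1r => /eqP /(mulIf dj) ->.
have [y yij Ft] := split_torus_one_parameter PU FQ Fconn Fdiag Fs sij.
set t := _ *m _ *m _ in Ft.
have [e e0 [l [l0 l1 ew et]]] :=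
  contracted_integral_row PU (real_points_det FQ Ft) yij wij (Fw _ Ft).
(* [tau] is [t] or its inverse, whichever expands [e]. *)
have [tau [mu mu1 etau]] : exists tau : elt G, exists2 mu : R, 1 < mu &
    map_mx intr e *m mx_of tau = mu *: map_mx intr e.
  case: (ltgtP l 1) l1 => // ll _; last by exists (Elt (FG _ Ft)), l.
  have GtV : mxgroup_set G (invmx t).
    by case: (mxgroupP G) => _ _ _ GV; apply: GV; exact: FG.
  exists (Elt GtV), l^-1; first by rewrite invf_gt1.
  rewrite -[in RHS](mulmxK (FU _ Ft) (map_mx intr e)) et -scalemxAl scalerA.
  by rewrite mulVf ?gt_eqF // scale1r.
apply: (expanded_row_not_equidistributed Gcom nuG xi_eq v_nil e0 _ mu1 etau).
(* The row e xi is killed by [v], since xi v = w xi and e w = 0. *)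
by rewrite -mulmxA -wxi mulmxA ew mul0mx.
Qed.
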